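(* Let $R$ be a semi-local ring with $2\in R^\times$. Then the symmetric monoidal category $(\mathrm{Quad}(R),\perp,0)$ of non-singular quadratic modules over $R$ is homogeneous; that is, the zero module $0$ is initial and for all objects $X,Y$: (H1) the group $\mathrm{Aut}(Y)$ acts transitively by postcomposition on $\mathrm{Hom}(X,Y)$; and (H2) the homomorphism $\mathrm{Aut}(X)\to\mathrm{Aut}(X\perp Y)$, $f\mapsto f\perp\mathrm{id}_Y$, is injective with image the set of $\varphi\in\mathrm{Aut}(X\perp Y)$ satisfying $\varphi\circ\iota_Y=\iota_Y$, where $\iota_Y:Y\to X\perp Y$ is $y\mapsto(0,y)$.
   Context: A quadratic module over a commutative ring $R$ is a pair $(V,q)$ with $V$ a finitely generated projective $R$-module and $q:V\to R$ with $q(ax)=a^2q(x)$ and $B_q(x,y)=q(x+y)-q(x)-q(y)$ bilinear; it is non-singular if $x\mapsto B_q(x,-)$ is an isomorphism $V\to\mathrm{Hom}_R(V,R)$. $\mathrm{Quad}(R)$ is the category of non-singular quadratic modules with morphisms the $R$-linear maps $f:(V,q)\to(V',q')$ with $q'(f(v))=q(v)$. The orthogonal sum is $(V_1,q_1)\perp(V_2,q_2)=(V_1\oplus V_2,(x_1,x_2)\mapsto q_1(x_1)+q_2(x_2))$, with $f_1\perp f_2=f_1\oplus f_2$; the unit is the zero module. A ring is semi-local if it has finitely many maximal ideals. *)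

(* Defs.v *)
From HB Require Import structures.
From mathcomp Require Import all_boot all_order all_algebra.
Set Implicit Arguments. Unset Strict Implicit. Unset Printing Implicit Defensive.
Import GRing.Theory.
Local Open Scope ring_scope.

Section Ring.
Variable R : comPzRingType.

(* An ideal of R, as a predicate (membership need not be decidable). *)
Definition is_ideal (I : R -> Prop) : Prop :=
  [/\ I 0, (forall x y, I x -> I y -> I (x + y)) & (forall a x, I x -> I (a * x))].

Definition is_maximal_ideal (I : R -> Prop) : Prop :=
  [/\ is_ideal I, ~ I 1 &
      forall J : R -> Prop, is_ideal J -> (forall x, I x -> J x) ->
        J 1 \/ (forall x, J x <-> I x)].

Definition semi_local : Prop :=
  exists (n : nat) (M : 'I_n -> R -> Prop),
    forall I, is_maximal_ideal I -> exists i, forall x, I x <-> M i x.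

Definition Rlinear (U W : lmodType R) (f : U -> W) : Prop :=
  forall (a : R) (x y : U), f (a *: x + y) = a *: f x + f y.

Definition Rlinear_form (U : lmodType R) (l : U -> R) : Prop :=
  forall (a : R) (x y : U), l (a *: x + y) = a * l x + l y.

Definition fg_projective (V : lmodType R) : Prop :=
  exists (n : nat) (i : V -> 'rV[R]_n) (p : 'rV[R]_n -> V),
    [/\ Rlinear i, Rlinear p & cancel i p].

Definition polar (V : lmodType R) (q : V -> R) (x y : V) : R :=
  q (x + y) - q x - q y.

Definition quadratic_form (V : lmodType R) (q : V -> R) : Prop :=
  [/\ forall (a : R) (x : V), q (a *: x) = a ^+ 2 * q x,
      forall x, Rlinear_form (polar q x) &
      forall y, Rlinear_form (fun x => polar q x y)].

(* Non-singular: x |-> B_q(x,-) is an isomorphism V -> Hom_R(V,R)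
   (it is R-linear by bilinearity; we require it to be bijective). *)
Definition nonsingular (V : lmodType R) (q : V -> R) : Prop :=
  injective (polar q) /\
  forall l : V -> R, Rlinear_form l -> exists x : V, polar q x = l.

Record QuadMod := {
  qcarrier :> lmodType R;
  qform : qcarrier -> R;
  qcarrier_fgp : fg_projective qcarrier;
  qform_quadratic : quadratic_form qform;
  qform_nonsingular : nonsingular qform }.


Definition is_qmorph (V W : lmodType R) (q : V -> R) (q' : W -> R) (f : V -> W) : Prop :=
  Rlinear f /\ forall v, q' (f v) = q v.

Definition is_qaut (V : lmodType R) (q : V -> R) (f : V -> V) : Prop :=
  is_qmorph q q f /\
  exists g : V -> V, [/\ is_qmorph q q g, cancel f g & cancel g f].

Definition osum_form (V1 V2 : lmodType R) (q1 : V1 -> R) (q2 : V2 -> R)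
  (x : V1 * V2) : R := q1 x.1 + q2 x.2.

Definition osum_map (V1 V2 W1 W2 : lmodType R) (f1 : V1 -> W1) (f2 : V2 -> W2)
  (x : V1 * V2) : W1 * W2 := (f1 x.1, f2 x.2).

Definition iota_r (V1 V2 : lmodType R) (y : V2) : V1 * V2 := (0, y).

Definition ZeroMod : lmodType R := 'rV[R]_0.
Definition zero_form (x : ZeroMod) : R := 0.

End Ring.
Arguments qform {R} q _.

Definition quad_homogeneous (R : comPzRingType) : Prop :=
  (forall X : QuadMod R,
     (exists f : ZeroMod R -> qcarrier X, is_qmorph (@zero_form R) (qform X) f) /\
     (forall f g : ZeroMod R -> qcarrier X,
        is_qmorph (@zero_form R) (qform X) f ->
        is_qmorph (@zero_form R) (qform X) g -> f = g)) /\
  (forall (X Y : QuadMod R) (f g : qcarrier X -> qcarrier Y),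
     is_qmorph (qform X) (qform Y) f -> is_qmorph (qform X) (qform Y) g ->
     exists s : qcarrier Y -> qcarrier Y, is_qaut (qform Y) s /\ g = s \o f) /\
  (forall X Y : QuadMod R,
     let qXY := osum_form (qform X) (qform Y) in
     (forall f : X -> qcarrier X, is_qaut (qform X) f ->
        is_qaut qXY (osum_map f id) /\
        osum_map f id \o @iota_r R (qcarrier X) (qcarrier Y) = @iota_r R (qcarrier X) (qcarrier Y)) /\
     (forall f g : X -> qcarrier X, is_qaut (qform X) f -> is_qaut (qform X) g ->
        osum_map f (@id (qcarrier Y)) = osum_map g (@id (qcarrier Y)) -> f = g) /\
     (forall phi : (qcarrier X * qcarrier Y)%type -> (qcarrier X * qcarrier Y)%type, is_qaut qXY phi ->
        phi \o @iota_r R (qcarrier X) (qcarrier Y) = @iota_r R (qcarrier X) (qcarrier Y) ->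
        exists f : X -> qcarrier X, is_qaut (qform X) f /\ phi = osum_map f id)).

(* Main.v *)
(**
  Extension of isometries.  Let [f, g : X -> Y] be isometries.  By induction on the
  rank of the image of a self-adjoint projection [r] of [X] such that [f = g] on
  [ker r], one builds an isometry [s] of [Y] with [g = s o f]: split off from the
  image of [r] a vector [x] whose value [q x] is invertible on the whole support of
  this image, move [f x] to [g x] by an isometry fixing [f (ker r)] pointwise, and
  continue with [r] restricted to the orthogonal complement of [x].  Supports are
  idempotents: that of the image of a projection [r] is the complement of
  [det (1 - r)], so the ring need not be decomposed into connected factors.

  The line [f x] is moved to [g x] by reflections inside the orthogonal complement
  of [f (ker r)].  Where [f x] spans that complement, [f x] and [g x] differ by a
  square root of 1, i.e. by a reflection on an idempotent part of the spectrum.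
  Elsewhere, at each maximal ideal some vector [w] (orthogonal or equal to [f x])
  makes [q (s_w (f x) - g x)] nonzero, [s_w] being the reflection in [w]; these
  choices are glued by the Chinese remainder theorem.
*)
Require Import Defs.
From mathcomp Require Import all_boot all_order all_fingroup all_algebra ring.
From mathcomp Require Import boolp classical_sets.
Set Implicit Arguments. Unset Strict Implicit. Unset Printing Implicit Defensive.
Import GRing.Theory.
Local Open Scope ring_scope.

(** * Maximal ideals, and prescribing values at finitely many of them *)

Section Ideals.
Variable R : comPzRingType.
Implicit Types (I m : R -> Prop) (a b e : R).

Lemma ideal_opp I a : is_ideal I -> I a -> I (- a).
Proof. by case=> _ _ IM Ia; rewrite -mulN1r; apply: IM. Qed.

Lemma ideal_sub I a b : is_ideal I -> I a -> I b -> I (a - b).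
Proof.
move=> idI Ia Ib; case: (idI) => _ ID _.
by apply: ID => //; apply: ideal_opp.
Qed.

Lemma ideal_mulr I a b : is_ideal I -> I a -> I (a * b).
Proof. by case=> _ _ IM Ia; rewrite mulrC; apply: IM. Qed.

Lemma maximal_ideal_comaximal m a :
  is_maximal_ideal m -> ~ m a -> exists b, m (1 - b * a).
Proof.
case=> idm m1 maxm ma; case: (idm) => m0 mD mM.
pose J x := exists b, m (x - b * a).
have idJ : is_ideal J.
  split=> [|x y [b mb] [c mc]|c x [b mb]].
  - by exists 0; rewrite mul0r subr0.
  - exists (b + c); have -> : x + y - (b + c) * a = (x - b * a) + (y - c * a) by ring.
    exact: mD.
  - exists (c * b); have -> : c * x - c * b * a = c * (x - b * a) by ring.
    exact: mM.
have [x mx|//|Jm] := maxm J idJ.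
  by exists 0; rewrite mul0r subr0.
by case: ma; apply/Jm; exists 1; rewrite mul1r subrr.
Qed.

Lemma maximal_ideal_prime m a b : is_maximal_ideal m -> m (a * b) -> m a \/ m b.
Proof.
move=> maxm mab; have [ma|ma] := pselect (m a); first by left.
have [c mc] := maximal_ideal_comaximal maxm ma.
have [idm _ _] := maxm; have [_ mD mM] := idm.
right; have -> : b = b * (1 - c * a) + c * (a * b) by ring.
by apply: mD; apply: mM.
Qed.

Lemma maximal_ideal_idem m e :
  is_maximal_ideal m -> e * e = e -> ~ m (1 - e) -> m e.
Proof.
move=> maxm ee me; have [[m0 _ _] _ _] := maxm.
have [||//] := @maximal_ideal_prime m e (1 - e) maxm; last by [].
by rewrite mulrBr mulr1 ee subrr.
Qed.

Lemma maximal_ideal_compl m e : is_maximal_ideal m -> m e -> ~ m (1 - e).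
Proof.
case=> -[_ mD _] m1 _ me mce; apply: m1.
by rewrite -(subrK e 1); apply: mD.
Qed.

Lemma krull I : is_ideal I -> ~ I 1 ->
  exists m, is_maximal_ideal m /\ forall x, I x -> m x.
Proof.
move=> idI I1.
pose P (J : set R) := J = set0 \/ [/\ is_ideal J, ~ J 1 & forall x, I x -> J x].
have [F FP Ftot|m [Pm maxm]] := @Zorn_bigcup R P.
  have [[J [FJ [x Jx]]]|F0] := pselect (exists J, F J /\ exists x, J x); last first.
    left; apply/seteqP; split=> // x [J FJ Jx].
    by case: F0; exists J; split=> //; exists x.
  have FP' K y : F K -> K y -> [/\ is_ideal K, ~ K 1 & forall x, I x -> K x].
    by move=> /FP [->|].
  right; split.
  - split.
    + by exists J => //; have [[]] := FP' _ _ FJ Jx.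
    + move=> y z [K FK Ky] [L FL Lz].
      have [[_ KD _] _ _] := FP' _ _ FK Ky; have [[_ LD _] _ _] := FP' _ _ FL Lz.
      have [KL|LK] := Ftot _ _ FK FL.
        by exists L => //; apply: LD => //; apply: KL.
      by exists K => //; apply: KD => //; apply: LK.
    + move=> b y [K FK Ky]; exists K => //.
      by have [[_ _ KM] _ _] := FP' _ _ FK Ky; apply: KM.
  - by move=> [K FK K1]; have [] := FP' _ _ FK K1.
  - by move=> y Iy; exists J => //; have [_ _] := FP' _ _ FJ Jx; apply.
have [idm m1 Im] : [/\ is_ideal m, ~ m 1 & forall x, I x -> m x].
  case: Pm => // m0; exfalso; have /maxm : (m `<` I)%classic.
    split; first by rewrite m0.
    by rewrite m0 => /(_ 0); apply; case: idI.
  by apply; right.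
exists m; split=> //; split=> // J idJ mJ.
have [J1|J1] := pselect (J 1); [by left|right=> x; split; last exact: mJ].
move=> Jx; apply: contrapT => mx; apply: (maxm J).
  by split=> // /(_ x Jx).
by right; split=> // y /Im /mJ.
Qed.

(** Otherwise the principal ideal of [a] is proper and lies in some maximal ideal. *)
Lemma unit_of_maximal a :
  (forall m, is_maximal_ideal m -> ~ m a) -> exists b, b * a = 1.
Proof.
move=> ma; apply: contrapT => a1.
have [||m [maxm am]] := @krull (fun x => exists b, b * a = x).
- split=> [|x y [b <-] [c <-]|c x [b <-]].
  + by exists 0; rewrite mul0r.
  + by exists (b + c); rewrite mulrDl.
  + by exists (c * b); rewrite mulrA.
- exact: a1.
- by apply: (ma m) => //; apply: am; exists 1; rewrite mul1r.
Qed.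

Lemma maximal_ideal_separate m1 m2 :
  is_maximal_ideal m1 -> is_maximal_ideal m2 -> m1 <> m2 ->
  exists a, m1 a /\ m2 (1 - a).
Proof.
move=> max1 max2 neq.
have [a [m1a m2a]] : exists a, m1 a /\ ~ m2 a.
  apply: contrapT => sub12; have [id1 _ maxm1] := max1; have [id2 m21 _] := max2.
  have [x m1x|//|m12] := maxm1 m2 id2.
    by apply: contrapT => m2x; apply: sub12; exists x.
  by apply: neq; apply/funext => x; apply/propext; rewrite m12.
have [b m2b] := maximal_ideal_comaximal max2 m2a.
by exists (b * a); split=> //; have [[_ _ mM] _ _] := max1; apply: mM.
Qed.

(** Multiply elements of the various [M i] that are congruent to 1 modulo [m]. Entries that are not
    maximal, or equal to [m], contribute no factor. *)
Lemma maximal_ideals_avoid n (M : nat -> R -> Prop) m :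
  is_maximal_ideal m ->
  exists a, m (1 - a) /\
    forall i, (i < n)%N -> is_maximal_ideal (M i) -> M i <> m -> M i a.
Proof.
move=> maxm; have [[m0 mD mM] _ _] := maxm.
elim: n => [|n [a [ma Ma]]]; first by exists 1; rewrite subrr.
have [[maxMn neq]|triv] := pselect (is_maximal_ideal (M n) /\ M n <> m); last first.
  exists a; split=> // i; rewrite ltnS leq_eqVlt => /orP[/eqP->|/Ma//] maxM neq.
  by case: triv.
have [b [Mb mb]] := maximal_ideal_separate maxMn maxm neq.
exists (b * a); split.
  by have -> : 1 - b * a = (1 - b) + b * (1 - a) by [ring]; apply: mD => //; apply: mM.
move=> i; rewrite ltnS leq_eqVlt => /orP[/eqP->|ltin] maxM neqi.
  by apply: ideal_mulr => //; have [] := maxM.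
by have [[_ _ MM] _ _] := maxM; apply: MM; apply: Ma.
Qed.

(* The class of [F v] modulo an ideal [I] only depends on [v] modulo [I V]; for
   such [F], values can be prescribed at finitely many maximal ideals independently. *)
Definition congruence_preserving (V : lmodType R) (F : V -> R) : Prop :=
  forall I a v w, is_ideal I -> I a -> I (F (v + a *: w) - F v).

(** The vector is corrected at one maximal ideal after another, keeping its class at the earlier
    ones. In the end [F v] is invertible where [d] is 1, and [a] is its inverse there. *)
Lemma semi_local_choose (V : lmodType R) (F : V -> R) (d : R) :
  semi_local R ->
  congruence_preserving F ->
  d * d = d ->
  (forall m, is_maximal_ideal m -> ~ m d -> exists v, ~ m (F v)) ->
  exists v a, a * F v = d.
Proof.
move=> [n [M0 MP0]] FP dd Fm.
(* Indices out of range get the empty predicate, which is not an ideal. *)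
pose M i := if insub i is Some j then M0 j else fun=> False.
have MP m : is_maximal_ideal m -> exists2 i, (i < n)%N & M i = m.
  move=> /MP0 [i mi]; exists i => //; rewrite /M valK.
  by apply/funext => x; apply/propext; rewrite mi.
have [v vP] : exists v, forall i, (i < n)%N ->
    is_maximal_ideal (M i) -> ~ M i d -> ~ M i (F v).
  elim: (n) => [|k [v vP]]; first by exists 0.
  have [[maxk kd]|triv] := pselect (is_maximal_ideal (M k) /\ ~ M k d); last first.
    exists v => i; rewrite ltnS leq_eqVlt => /orP[/eqP->|/vP//] maxi di.
    by case: triv.
  have [w wP] := Fm _ maxk kd.
  (* Since [a] is 1 modulo [M k] and 0 modulo the other earlier maximal ideals, [v + a *: (w - v)]
     is congruent to [w] at the former and to [v] at the latter. *)
  have [a [ka aP]] := maximal_ideals_avoid k M maxk.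
  have [idk _ _] := maxk.
  have wk : ~ M k (F (v + a *: (w - v))).
    have -> : v + a *: (w - v) = w + (1 - a) *: (v - w).
      by rewrite scalerBl scale1r addrA subrKC -scalerN opprB.
    move=> kF; apply: wP.
    have := FP _ _ w (v - w) idk ka => /(ideal_sub idk kF).
    by rewrite opprB addrC subrK.
  exists (v + a *: (w - v)) => i.
  have [->//|neq] := pselect (M i = M k).
  rewrite ltnS leq_eqVlt => /orP[/eqP eik|ltik] maxi di; first by rewrite eik in neq.
  have [idi _ _] := maxi.
  have ia := aP _ ltik maxi neq.
  move=> iF; apply: (vP _ ltik maxi di).
  have := FP _ _ v (w - v) idi ia => /(ideal_sub idi iF).
  by rewrite opprB addrC subrK.
(* This element is [F v] where [d] is 1, and 1 where [d] is 0. *)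
have [|b bP] := @unit_of_maximal (d * F v + (1 - d)).
  move=> m maxm; have [i lti eqm] := MP _ maxm; subst m.
  have [idm _ _] := maxm; have [m0 mD mM] := idm.
  have [md|md] := pselect (M i d) => mF.
    apply: (maximal_ideal_compl maxm md).
    have := ideal_sub idm mF (ideal_mulr (F v) idm md).
    by rewrite addrC addrA addNr add0r.
  have : M i (d * (d * F v + (1 - d))) by apply: mM.
  have -> : d * (d * F v + (1 - d)) = d * d * F v + (d - d * d) by ring.
  by rewrite dd subrr addr0 => /(maximal_ideal_prime maxm) [//|]; apply: vP.
exists v, (b * d).
have -> : b * d * F v = d * (b * (d * F v + (1 - d))) +
  b * F v * (d - d * d) - b * (d - d * d) by ring.
by rewrite bP dd; ring.
Qed.

End Ideals.

(** * Linear maps, congruences and determinants *)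

Section LinearAlgebra.
Variable R : comPzRingType.

Lemma congruence_preservingD (V : lmodType R) (F G : V -> R) :
  congruence_preserving F -> congruence_preserving G ->
  congruence_preserving (fun v => F v + G v).
Proof.
move=> FP GP I a v w idI Ia; have [_ ID _] := idI.
rewrite opprD addrACA; apply: ID; [exact: FP|exact: GP].
Qed.

Lemma congruence_preservingM (V : lmodType R) (F G : V -> R) :
  congruence_preserving F -> congruence_preserving G ->
  congruence_preserving (fun v => F v * G v).
Proof.
move=> FP GP I a v w idI Ia; have [_ ID IM] := idI.
set v' := v + _.
have -> : F v' * G v' - F v * G v = F v' * (G v' - G v) + G v * (F v' - F v) by ring.
by apply: ID; apply: IM; [exact: GP|exact: FP].
Qed.

Lemma congruence_preserving_cst (V : lmodType R) (c : R) :
  congruence_preserving (fun _ : V => c).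
Proof. by move=> I a v w [I0 _ _] _; rewrite subrr. Qed.

Lemma congruence_preserving_form (V : lmodType R) (l : V -> R) :
  Rlinear_form l -> congruence_preserving l.
Proof.
move=> lL I a v w idI Ia; rewrite (addrC v) lL addrK.
exact: ideal_mulr.
Qed.

Section Rlinear.
Variables (U W : lmodType R) (f : U -> W).
Hypothesis fL : Rlinear f.

Lemma Rlinear0 : f 0 = 0.
Proof. by have := fL (-1) 0 0; rewrite scaler0 addr0 scaleN1r addNr. Qed.

Lemma RlinearD x y : f (x + y) = f x + f y.
Proof. by have := fL 1 x y; rewrite !scale1r. Qed.

Lemma RlinearZ a x : f (a *: x) = a *: f x.
Proof. by have := fL a x 0; rewrite Rlinear0 !addr0. Qed.

Lemma RlinearB x y : f (x - y) = f x - f y.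
Proof. by rewrite RlinearD -scaleN1r RlinearZ scaleN1r. Qed.

Lemma Rlinear_sum (J : finType) (a : J -> R) (x : J -> U) :
  f (\sum_j a j *: x j) = \sum_j a j *: f (x j).
Proof.
elim/big_rec2: _ => [|j y z _ <-]; first exact: Rlinear0.
by rewrite RlinearD RlinearZ.
Qed.
End Rlinear.

Lemma Rlinear_comp (U V W : lmodType R) (f : V -> W) (g : U -> V) :
  Rlinear f -> Rlinear g -> Rlinear (f \o g).
Proof. by move=> fL gL a x y; rewrite /= gL fL. Qed.

Lemma Rlinear_matrix n p (f : 'rV[R]_n -> 'rV[R]_p) :
  Rlinear f -> exists A : 'M_(n, p), forall x, f x = x *m A.
Proof.
move=> fL; exists (\matrix_(k, j) f (delta_mx 0 k) 0 j) => x.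
rewrite {1}(row_sum_delta x) (Rlinear_sum fL); apply/rowP => j.
by rewrite summxE !mxE; apply: eq_bigr => k _; rewrite !mxE.
Qed.

Lemma det_congr (I : R -> Prop) n (A B : 'M[R]_n) :
  is_ideal I -> (forall i j, I (A i j - B i j)) -> I (\det A - \det B).
Proof.
move=> idI AB; have [I0 ID IM] := idI.
rewrite /determinant -sumrB; apply: (big_ind I) => // s _.
rewrite -mulrBr; apply: (IM).
elim/big_rec2: _ => [|i y z _ yz]; first by rewrite subrr.
have -> : A i (s i) * z - B i (s i) * y =
   A i (s i) * (z - y) + y * (A i (s i) - B i (s i)) by ring.
by apply: ID; apply: IM.
Qed.

(** Padding [A] with a zero column and [B] with a zero row makes both square without changing the
    product. *)
Lemma det_mulmx_thin n (A : 'M[R]_(n.+1, n)) (B : 'M[R]_(n, n.+1)) :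
  \det (A *m B) = 0.
Proof.
have -> : A *m B = row_mx (0 : 'cV_n.+1) A *m col_mx (0 : 'rV_n.+1) B.
  by rewrite mul_row_col mul0mx add0r.
rewrite det_mulmx.
rewrite (expand_det_col (row_mx (0 : 'cV_n.+1) A : 'M_(1 + n)) (lshift n ord0)).
rewrite big1 ?mul0r // => i _.
by rewrite row_mxEl mxE mul0r.
Qed.

End LinearAlgebra.

(** * Polar forms, reflections and supports of projections *)

Section QuadraticForms.
Variables (R : comPzRingType) (V : lmodType R) (q : V -> R).
Hypothesis qq : quadratic_form q.
Local Notation b := (polar q).

Lemma qformD x y : q (x + y) = q x + q y + b x y.
Proof. by rewrite /polar -[X in _ = _ + X]addrA -opprD subrKC. Qed.

Lemma qformZ a x : q (a *: x) = a * a * q x.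
Proof. by have [-> _ _] := qq; rewrite expr2. Qed.

Lemma polarC x y : b x y = b y x.
Proof. by rewrite /polar (addrC x) addrAC. Qed.

Lemma polarDr x y z : b x (y + z) = b x y + b x z.
Proof. by have [_ /(_ x 1 y z)] := qq; rewrite scale1r mul1r. Qed.

Lemma polar0r x : b x 0 = 0.
Proof. by apply: (addrI (b x 0)); rewrite -polarDr !addr0. Qed.

Lemma polarZr x a y : b x (a *: y) = a * b x y.
Proof. by have [_ /(_ x a y 0)] := qq; rewrite polar0r !addr0. Qed.

Lemma polarNr x y : b x (- y) = - b x y.
Proof. by rewrite -scaleN1r polarZr mulN1r. Qed.

Lemma polarDl x y z : b (x + y) z = b x z + b y z.
Proof. by rewrite !(polarC _ z) polarDr. Qed.

Lemma polarZl a x y : b (a *: x) y = a * b x y.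
Proof. by rewrite !(polarC _ y) polarZr. Qed.

Lemma polarNl x y : b (- x) y = - b x y.
Proof. by rewrite !(polarC _ y) polarNr. Qed.

Lemma polar0l y : b 0 y = 0.
Proof. by rewrite polarC polar0r. Qed.

Definition polarE := (polarDl, polarDr, polarNl, polarNr, polarZl, polarZr).

Lemma qform0 : q 0 = 0.
Proof. by rewrite -(scale0r 0) qformZ !mul0r. Qed.

Lemma polarxx x : b x x = 2 * q x.
Proof.
by rewrite /polar -mulr2n -scaler_nat qformZ; ring.
Qed.

Lemma qformN x : q (- x) = q x.
Proof. by rewrite -scaleN1r qformZ; ring. Qed.

Lemma qform_congruence_preserving : congruence_preserving q.
Proof.
move=> I a v w idI Ia.
rewrite qformD qformZ polarZr.
have -> : q v + a * a * q w + a * b v w - q v = a * (a * q w + b v w) by ring.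
exact: ideal_mulr.
Qed.

Lemma qmorph_polar (W : lmodType R) (q' : W -> R) (f : V -> W) x y :
  is_qmorph q q' f -> polar q' (f x) (f y) = b x y.
Proof. by case=> fL fq; rewrite /polar -(RlinearD fL) !fq. Qed.

Definition self_adjoint_projection (r : V -> V) : Prop :=
  [/\ Rlinear r, forall x, r (r x) = r x & forall x y, b (r x) y = b x (r y)].

(* For [w] with [k * q w = 1] this is the orthogonal reflection in [w]. Under the
   weaker condition [k * k * q w = k] it is the reflection over the part of the
   spectrum cut out by the idempotent [k * q w], and the identity elsewhere. *)
Definition reflection (k : R) (w z : V) : V := z - (k * b w z) *: w.

Lemma reflection_Rlinear k w : Rlinear (reflection k w).
Proof.
move=> a x y; rewrite /reflection !polarE scalerBr scalerA mulrDr scalerDl.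
by rewrite opprD addrACA; congr (_ - _ *: _ + _); ring.
Qed.

Lemma reflection_qform k w z : k * k * q w = k -> q (reflection k w z) = q z.
Proof.
move=> kw; rewrite /reflection qformD qformN qformZ !polarE (polarC z w).
have -> : q z + k * b w z * (k * b w z) * q w - k * b w z * b w z =
  q z + b w z * b w z * (k * k * q w - k) by ring.
by rewrite kw subrr mulr0 addr0.
Qed.

Lemma reflectionK k w : k * k * q w = k -> involutive (reflection k w).
Proof.
move=> kw z; rewrite /reflection !polarE polarxx -addrA -opprD -scalerDl.
have -> : k * b w z + k * (b w z - k * b w z * (2 * q w)) =
   2 * b w z * (k - k * k * q w) by ring.
by rewrite kw subrr mulr0 scale0r subr0.
Qed.

Lemma reflection_qaut k w : k * k * q w = k -> is_qaut q (reflection k w).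
Proof.
move=> kw.
have rM : is_qmorph q q (reflection k w).
  by split; [exact: reflection_Rlinear|move=> z; exact: reflection_qform].
by split=> //; exists (reflection k w); split=> //; exact: reflectionK.
Qed.

Lemma reflection_orth k w z : b w z = 0 -> reflection k w z = z.
Proof. by move=> wz; rewrite /reflection wz mulr0 scale0r subr0. Qed.

Lemma qaut_id : is_qaut q id.
Proof. by split; [|exists id; split]. Qed.

Lemma qaut_comp s t : is_qaut q s -> is_qaut q t -> is_qaut q (s \o t).
Proof.
have comp (f g : V -> V) :
    is_qmorph q q f -> is_qmorph q q g -> is_qmorph q q (f \o g).
  move=> [fL fq] [gL gq]; split; first exact: Rlinear_comp.
  by move=> z; rewrite /= fq gq.
move=> [sM [s' [s'M sK s'K]]] [tM [t' [t'M tK t'K]]].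
split; first exact: comp.
by exists (t' \o s'); split; [exact: comp|exact: can_comp|exact: can_comp].
Qed.

(* The idempotent is [\det (1 - r)]; at a maximal ideal not containing it, [1 - r]
   is invertible, so [r] vanishes there. *)
Lemma projection_support (r : V -> V) :
  fg_projective V -> nonsingular q -> self_adjoint_projection r ->
  exists e : R, [/\ e * e = e, forall z, e *: r z = 0 &
    forall m, is_ideal m -> ~ m 1 -> m e -> exists z, ~ m (q (r z))].
Proof.
move=> [n [i [p [iL pL ip]]]] [_ qsurj] [rL rr radj].
(* [A] is the matrix of [r] extended by zero to the free module. *)
have [A AP] := Rlinear_matrix (Rlinear_comp iL (Rlinear_comp rL pL)).
have AA : A *m A = A.
  by apply/row_matrixP => k; rewrite !rowE mulmxA -!AP /= ip rr.
exists (\det (1%:M - A)); split.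
- rewrite -det_mulmx mulmxBl !mulmxBr !mul1mx mulmx1 AA.
  by rewrite subrr subr0.
- move=> z; rewrite -[LHS]ip (RlinearZ iL).
  (* What [1 - A] kills is killed by its determinant, through the adjugate. *)
  have irz : i (r z) *m (1%:M - A) = 0.
    by rewrite mulmxBr mulmx1 -AP /= ip rr subrr.
  by rewrite -mul_mx_scalar -mul_mx_adj mulmxA irz mul0mx (Rlinear0 pL).
- move=> m idm m1 me; have [m0 mD mM] := idm; apply: contrapT => mqr.
  have {}mqr z : m (q (r z)) by apply: contrapT => mz; apply: mqr; exists z.
  have mb x y : m (b (r x) y).
    rewrite -(rr x) radj /polar -(RlinearD rL).
    by do 2!apply: ideal_sub => //.
  have mA k j : m (A k j).
    (* By non-singularity each coordinate is a polar form, so the entries of [A] are polar values on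
       the image of [r], and these lie in [m]. *)
    have [w wP] : exists w, b w = fun z => i z 0 j.
      by apply: qsurj => a x y; rewrite iL !mxE.
    have -> : A k j = b w (r (p (delta_mx 0 k))).
      by rewrite wP -[i _]/((i \o (r \o p)) _) AP -rowE mxE.
    by rewrite polarC.
  apply: m1; rewrite -(subrK (\det (1%:M - A)) 1); apply: mD => //.
  rewrite -{1}(det1 R n); apply: det_congr => // k j.
  by rewrite !mxE opprB addrC subrK.
Qed.

End QuadraticForms.

(** * Transitivity of isometries *)

Section Extension.
Variables (R : comPzRingType) (h : R).
Hypotheses (h2 : 2 * h = 1) (Rsl : semi_local R).

Definition split_off (V : lmodType R) (q : V -> R) (r : V -> V) (x : V) (u : R)
    (z : V) : V :=
  r z - (h * u * polar q x z) *: x.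

Lemma split_off_line (V : lmodType R) (q : V -> R) (r : V -> V) x u :
  quadratic_form q -> r x = x -> (u * q x) *: x = x -> split_off q r x u x = 0.
Proof.
move=> qq rx ux; rewrite /split_off rx (polarxx qq).
have -> : h * u * (2 * q x) = 2 * h * (u * q x) by ring.
by rewrite h2 mul1r ux subrr.
Qed.

Lemma split_off_projection (V : lmodType R) (q : V -> R) (r : V -> V) x u :
  quadratic_form q -> self_adjoint_projection q r ->
  r x = x -> (u * q x) *: x = x ->
  self_adjoint_projection q (split_off q r x u).
Proof.
move=> qq [rL rr radj] rx ux; split=> [a y z|z|y z]; rewrite /split_off.
- rewrite rL !(polarE qq) scalerBr scalerA mulrDr scalerDl opprD addrACA.
  by congr (_ - _ *: _ + _); ring.
- rewrite (RlinearB rL) (RlinearZ rL) rx rr -addrA -opprD -scalerDl.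
  rewrite !(polarE qq) (polarxx qq) -radj rx; congr (_ - _).
  have -> : h * u * (polar q x z - h * u * polar q x z * (2 * q x)) =
      h * u * polar q x z * (1 - 2 * h * (u * q x)) by ring.
  by rewrite h2 mul1r scalerDl -[X in _ + X]scalerA scalerBl scale1r ux subrr
    scaler0 addr0.
- by rewrite !(polarE qq) radj (polarC _ y x); ring.
Qed.

Lemma exists_regular_vector (V : lmodType R) (q : V -> R) (r : V -> V) :
  quadratic_form q -> nonsingular q -> fg_projective V ->
  self_adjoint_projection q r ->
  exists x u, [/\ r x = x, u * u * q x = u & forall z, (u * q x) *: r z = r z].
Proof.
move=> qq qns Vfgp rP; have [rL rr radj] := rP.
have [e [ee er em]] := projection_support Vfgp qns rP.
have dd : (1 - e) * (1 - e) = 1 - e by rewrite mulrBr mulr1 mulrBl mul1r ee subrr subr0.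
have [||x [v vP]] := @semi_local_choose _ _ (q \o r) _ Rsl _ dd.
- move=> I a y z idI Ia; rewrite /= (RlinearD rL) (RlinearZ rL).
  exact: (qform_congruence_preserving qq).
- move=> m maxm me; apply: em; [by case: maxm|by case: maxm|].
  exact: maximal_ideal_idem.
(* Cutting both down by [1 - e] makes [u * q x] exactly this idempotent, the support of the image of
   [r]. *)
exists ((1 - e) *: r x), ((1 - e) * v); rewrite (RlinearZ rL) rr (qformZ qq) /= in vP *.
have uq : (1 - e) * v * ((1 - e) * (1 - e) * q (r x)) = 1 - e.
  have -> : (1 - e) * v * ((1 - e) * (1 - e) * q (r x)) =
    (1 - e) * (1 - e) * ((1 - e) * (v * q (r x))) by ring.
  by rewrite vP !dd.
split=> // [|z].
  by rewrite -[in LHS]mulrA uq mulrC mulrA dd.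
by rewrite uq scalerBl scale1r er subr0.
Qed.

(* First reflect in a vector [w] in the image of [r], either orthogonal to [x] or
   congruent to [x] at each maximal ideal, so that the image [x'] of [x] has
   [q (x' - y)] invertible wherever [d] is; the reflection in [x' - y] then
   carries [x'] to [y]. *)
Lemma qaut_of_regular_pair (V : lmodType R) (q : V -> R) (r : V -> V) x y d :
  quadratic_form q -> self_adjoint_projection q r ->
  r x = x -> r y = y -> q x = q y -> d * d = d -> (1 - d) *: x = (1 - d) *: y ->
  (forall m, is_maximal_ideal m -> ~ m d -> ~ m (q x)) ->
  (forall m, is_maximal_ideal m -> ~ m d ->
     exists w, polar q (r w) x = 0 /\ ~ m (q (r w))) ->
  exists s, [/\ is_qaut q s, s x = y & forall z, r z = 0 -> s z = z].
Proof.
move=> qq [rL rr radj] rx ry qxy dd xy mqx mw.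
(* [c] is [q (x - y)], and [G w] is [q (s_w x - y)] times the square of [q w], so both factors are
   invertible where [G w] is. *)
set c := 2 * q x - polar q x y.
pose G w := q w * (q w * c + polar q w x * polar q w y).
have GP : congruence_preserving G.
  have qP := qform_congruence_preserving qq.
  have bP t : congruence_preserving (fun w => polar q w t).
    by apply: congruence_preserving_form; have [_ _] := qq; apply.
  apply: congruence_preservingM => //; apply: congruence_preservingD.
    by apply: congruence_preservingM => //; apply: congruence_preserving_cst.
  exact: congruence_preservingM.
have [||w0 [v vG]] := @semi_local_choose _ _ (G \o r) _ Rsl _ dd.
- move=> I a t z idI Ia; rewrite /= (RlinearD rL) (RlinearZ rL).
  exact: GP.
- move=> m maxm md; have pr := maximal_ideal_prime maxm.
  have [[m0 mD mM] m1 _] := maxm.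
  (* If [c] vanishes at [m], take [w = x]: then [s_x x = - x] and [q (x + y) = 4 * q x - c] is
     nonzero there. Otherwise a [w] orthogonal to [x] leaves [x] in place. *)
  have [mc|mc] := pselect (m c).
    exists x; rewrite /= rx /G (polarxx qq).
    have -> : q x * (q x * c + 2 * q x * polar q x y) =
      q x * (q x * (4 * q x - c)) by rewrite /c; ring.
    move=> /pr[|/pr[|mc']]; [exact: mqx|exact: mqx|].
    apply: (mqx _ maxm md).
    have -> : q x = h * h * (4 * q x - c + c) + (1 - (2 * h) * (2 * h)) * q x by ring.
    rewrite h2 mulr1 subrr mul0r addr0; apply: (mM); exact: mD.
  have [w [wx mqw]] := mw m maxm md.
  exists w; rewrite /= /G wx mul0r addr0.
  by move=> /pr[//|/pr[]].
rewrite /= in vG; have rw := rr w0; set w := r w0 in rw vG.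
set p := q w * c + polar q w x * polar q w y in vG.
have vqp : v * (q w * p) = d by [].
(* Where [d] is 1, [k] inverts [q w], and [l] below inverts [q t]. *)
pose k := d * v * p.
have kw : k * q w = d.
  have -> : k * q w = d * (v * (q w * p)) by rewrite /k; ring.
  by rewrite vqp.
have dk : d * k = k by rewrite /k !mulrA dd.
have kk : k * k * q w = k by rewrite -mulrA kw mulrC.
have [x' x'E] : exists x', x' = reflection q k w x by exists (reflection q k w x).
pose t := x' - y; pose l := d * v * q w * q w.
have rx' : r x' = x' by rewrite x'E /reflection (RlinearB rL) (RlinearZ rL) rx rw.
have rt : r t = t by rewrite (RlinearB rL) rx' ry.
have dl : d * l = l by rewrite /l !mulrA dd.
have qx' : q x' = q y by rewrite x'E reflection_qform.
have qt : q t = c + k * polar q w x * polar q w y.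
  rewrite /t qformD (qformN qq) qx' (polarNr qq) x'E /reflection !(polarE qq) /c qxy.
  by ring.
have lt : l * q t = d.
  have -> : l * q t = d * v * q w * (q w * c + k * q w * (polar q w x * polar q w y)).
    by rewrite qt /l; ring.
  have -> : d * v * q w * (q w * c + k * q w * (polar q w x * polar q w y)) =
     d * (v * (q w * p)) + v * q w * polar q w x * polar q w y * (d * (k * q w) - d).
    by rewrite /p; ring.
  by rewrite vqp kw dd subrr mulr0 addr0.
have ll : l * l * q t = l by rewrite -mulrA lt mulrC.
have dt : d *: t = t.
  apply/eqP; rewrite -subr_eq0 -opprB -[X in - (X - _)]scale1r -scalerBl oppr_eq0.
  rewrite scalerBr x'E /reflection scalerBr scalerA mulrA mulrBl mul1r dk subrr.
  by rewrite mul0r scale0r subr0 xy subrr.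
have btx' : polar q t x' = q t.
  by rewrite /t !(polarE qq) (polarxx qq) qformD (qformN qq) !(polarE qq) qx'
    (polarC _ y); ring.
exists (reflection q l t \o reflection q k w); split.
- by apply: qaut_comp; apply: reflection_qaut.
- by rewrite /= -x'E /reflection btx' lt dt /t subKr.
move=> z rz; have orth a : r a = a -> polar q a z = 0.
  by move=> ra; rewrite -ra radj rz polar0r.
by rewrite /= (reflection_orth _ (orth w rw)) (reflection_orth _ (orth t rt)).
Qed.

(** Let [e] cut out the locus where [x] has no orthogonal complement in the image of [r]. There
    [y = c x] with [c * c = 1] on the support of [x], and a sign change suffices; elsewhere the
    complement supplies the vectors that [qaut_of_regular_pair] needs. *)
Lemma qaut_transitive_line (V : lmodType R) (q : V -> R) (r : V -> V) x y u :
  quadratic_form q -> nonsingular q -> fg_projective V ->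
  self_adjoint_projection q r ->
  r x = x -> r y = y -> q x = q y -> u * u * q x = u ->
  (u * q x) *: x = x -> (u * q x) *: y = y ->
  exists s, [/\ is_qaut q s, s x = y & forall z, r z = 0 -> s z = z].
Proof.
move=> qq qns Vfgp rP rx ry qxy uu ux uy; have [rL rr radj] := rP.
have r1P := split_off_projection qq rP rx ux.
have [e [ee er em]] := projection_support Vfgp qns r1P.
set r1 := split_off q r x u in r1P er em.
have [f fE] : exists f, f = u * q x by exists (u * q x).
rewrite -fE in ux uy.
have ff : f * f = f.
  by rewrite fE mulrA (mulrC _ u) mulrA uu.
have uf : u * f = u by rewrite fE mulrA.
pose c := h * u * polar q x y.
have ey : e *: y = (e * c) *: x.
  by have /eqP := er y; rewrite /r1 /split_off ry scalerBr scalerA subr_eq0 => /eqP.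
have ec : e * f * c * c = e * f.
  have : e * e * q y = e * c * (e * c) * q x by rewrite -!(qformZ qq) ey.
  rewrite ee -qxy => eqx.
  have -> : e * f * c * c = e * e * f * c * c by rewrite ee.
  have -> : e * e * f * c * c = u * (e * c * (e * c) * q x) by rewrite fE; ring.
  by rewrite -eqx fE; ring.
(* As [c] squares to 1, [(1 - c) / 2] is the idempotent of the part where [c = -1]; this reflection
   negates [x] exactly there, within [e]. *)
pose k := e * (1 - c) * u * h.
have kk : k * k * q x = k.
  have -> : k * k * q x = e * e * (u * f) * h * h * (1 - c) * (1 - c).
    by rewrite /k fE; ring.
  rewrite ee uf.
  have -> : e * u * h * h * (1 - c) * (1 - c) =
      k * (2 * h) +
      h * h * (u * (1 - f) * e * (c * c - 1) + u * (e * f * c * c - e * f)).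
    by rewrite /k; ring.
  by rewrite h2 ec (mulrBr u 1 f) !mulr1 uf !subrr !(mul0r, mulr0, addr0).
have [x0 x0E] : exists x0, x0 = reflection q k x x by exists (reflection q k x x).
have x0E' : x0 = (1 - e) *: x + e *: y.
  rewrite x0E /reflection (polarxx qq) ey -{1}(scale1r x) -scalerDl -scalerBl.
  have -> : k * (2 * q x) = 2 * h * (e * (1 - c)) * f by rewrite /k fE; ring.
  rewrite h2 mul1r scalerBl -scalerA ux -scalerBl; congr (_ *: _); ring.
have rx0 : r x0 = x0 by rewrite x0E' (RlinearD rL) !(RlinearZ rL) rx ry.
have qx0 : q x0 = q x by rewrite x0E reflection_qform.
have eE (z : V) : f *: z = z -> (1 - (1 - e) * f) *: z = e *: z.
  move=> fz; have -> : 1 - (1 - e) * f = e * f + (1 - f) by ring.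
  by rewrite scalerDl -scalerA fz scalerBl scale1r fz subrr addr0.
have fx0 : f *: x0 = x0.
  by rewrite x0E' scalerDr !scalerA !(mulrC f) -!scalerA ux uy.
have [|||m maxm md|m maxm md|s [saut sx0 sz]] :=
  @qaut_of_regular_pair V q r x0 y ((1 - e) * f) qq rP rx0 ry.
- by rewrite qx0.
- rewrite mulrACA ff; congr (_ * f).
  by rewrite mulrBr mulr1 mulrBl mul1r ee subrr subr0.
- rewrite !eE // x0E' scalerDr !scalerA ee mulrBr mulr1 ee subrr scale0r add0r //.
- rewrite qx0 => mqx; apply: md; have [[_ _ mM] _ _] := maxm.
  by rewrite fE mulrA; apply: mM.
- have [idm m1 _] := maxm; have [_ _ mM] := idm.
  have [|z mz] := em m idm m1.
    apply: maximal_ideal_idem => // me; apply: md; exact: ideal_mulr.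
  (* [r1 z] is orthogonal to [x] by construction and to [e *: y] because [e] kills it, hence to
     [x0]. *)
  exists (r1 z); have [_ r1r1 _] := r1P.
  have rr1 z' : r (r1 z') = r1 z'.
    by rewrite /r1 /split_off (RlinearB rL) (RlinearZ rL) rr rx.
  rewrite rr1; split=> //.
  have r1x : r1 x = 0 by apply: split_off_line; rewrite // -fE.
  have [_ _ r1adj] := r1P.
  have b1x : polar q (r1 z) x = 0 by rewrite r1adj r1x polar0r.
  rewrite x0E' (polarDr qq) !(polarZr qq) b1x mulr0 add0r.
  by rewrite -(polarZl qq) er (polar0l qq).
exists (s \o reflection q k x); split.
- apply: qaut_comp => //; exact: reflection_qaut.
- by rewrite /= -x0E.
move=> z rz; rewrite /= reflection_orth ?sz //.
by rewrite -rx radj rz polar0r.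
Qed.


Lemma polar_suml (V : lmodType R) (q : V -> R) (J : finType) (a : J -> R)
    (x : J -> V) y :
  quadratic_form q -> polar q (\sum_j a j *: x j) y = \sum_j a j * polar q (x j) y.
Proof.
move=> qq; elim/big_rec2: _ => [|j t z _ <-]; first exact: polar0l.
by rewrite !(polarE qq).
Qed.

(* A division-free way of saying that the image of [r] has rank less than [n]. *)
Definition gram_vanish n (V : lmodType R) (q : V -> R) (r : V -> V) : Prop :=
  forall v : 'I_n -> V, \det (\matrix_(i, j) polar q (r (v i)) (r (v j))) = 0.

(** The Gram matrix of [n + 1] vectors factors through the free module of rank [n]. *)
Lemma fg_projective_gram_vanish (V : lmodType R) (q : V -> R) :
  quadratic_form q -> fg_projective V -> exists n, gram_vanish n.+1 q id.
Proof.
move=> qq [n [i [p [iL pL ip]]]]; exists n => v.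
pose A : 'M_(n.+1, n) := \matrix_(a, k) i (v a) 0 k.
pose B : 'M_(n, n.+1) := \matrix_(k, c) polar q (p (delta_mx 0 k)) (v c).
rewrite -[RHS](det_mulmx_thin A B); congr (\det _); apply/matrixP => a c.
rewrite !mxE -{1}(ip (v a)) (row_sum_delta (i (v a))) (Rlinear_sum pL).
by rewrite (polar_suml _ _ _ qq); apply: eq_bigr => k _; rewrite !mxE.
Qed.

Lemma gram_vanish_split_off n (V : lmodType R) (q : V -> R) (r : V -> V) x u :
  quadratic_form q -> self_adjoint_projection q r ->
  r x = x -> (forall z, (u * q x) *: r z = r z) ->
  gram_vanish n.+2 q r -> gram_vanish n.+1 q (split_off q r x u).
Proof.
move=> qq rP rx ur gr v; have [rL rr radj] := rP.
have ux : (u * q x) *: x = x by have := ur x; rewrite rx.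
have [_ r1r1 r1adj] := split_off_projection qq rP rx ux.
have r1x := split_off_line qq rx ux.
have rr1 z : r (split_off q r x u z) = split_off q r x u z.
  by rewrite /split_off (RlinearB rL) (RlinearZ rL) rr rx.
have ur1 z : (u * q x) *: split_off q r x u z = split_off q r x u z.
  by rewrite -rr1 ur.
have xr1 z : polar q x (split_off q r x u z) = 0 by rewrite -r1adj r1x polar0l.
set r1 := split_off q r x u in r1r1 r1adj r1x rr1 ur1 xr1 *.
set G := \matrix_(i, j) _.
(* Adjoining the orthogonal vector [x] gives a block diagonal Gram matrix, whence
   [2 * q x * \det G = 0]. *)
pose v' (i : 'I_(1 + n.+1)) := if split i is inr j then r1 (v j) else x.
have : \det (block_mx (2 * q x)%:M 0 0 G : 'M_(1 + n.+1)) = 0.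
  rewrite -[RHS](gr v'); congr (\det _).
  apply/matrixP => i j; rewrite !mxE /v'.
  case: (split i) => a; rewrite !mxE; case: (split j) => c; rewrite ?mxE ?rx ?rr1 //.
  - by rewrite !ord1 eqxx (polarxx qq).
  - by rewrite polarC xr1.
rewrite det_ublock det_scalar1 => qG.
(* As [G] has at least one row, [\det G] acquires a factor [u * q x], which makes [q x]
   cancellable. *)
have -> : G = (u * q x) *: G.
  by apply/matrixP => i j; rewrite !mxE -{1}ur1 (polarZl qq).
rewrite detZ exprS -mulrA mulrCA.
have -> : u * q x * \det G =
  h * u * (2 * q x * \det G) + u * q x * (1 - 2 * h) * \det G by ring.
by rewrite qG h2 subrr !(mulr0, mul0r) addr0 mulr0.
Qed.

(** Non-singularity of [q] represents each form [polar q' y \o f] by a unique vector; uniqueness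
    gives linearity. *)
Lemma exists_adjoint (X Y : lmodType R) (q : X -> R) (q' : Y -> R) (f : X -> Y) :
  quadratic_form q -> nonsingular q -> quadratic_form q' -> Rlinear f ->
  exists2 fs : Y -> X, Rlinear fs & forall y x, polar q (fs y) x = polar q' y (f x).
Proof.
move=> qq [qinj qsurj] qq' fL.
have /choice [fs fsP] y : exists z, polar q z = fun x => polar q' y (f x).
  by apply: qsurj => a x z; rewrite fL !(polarE qq').
exists fs => [a y z|y x]; last by rewrite fsP.
apply: qinj; apply/funext => x.
by rewrite !(polarE qq) !fsP !(polarE qq').
Qed.

(** With [fs] the adjoint of [f], [fs \o f = id], so [t = 1 - f (1 - r) fs] projects onto the
    orthogonal complement of [f (ker r) = g (ker r)]. *)
Lemma orth_image_projection (X Y : lmodType R) (q : X -> R) (q' : Y -> R)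
    (f g : X -> Y) (r : X -> X) :
  quadratic_form q -> nonsingular q -> quadratic_form q' ->
  is_qmorph q q' f -> is_qmorph q q' g ->
  self_adjoint_projection q r -> (forall z, r z = 0 -> f z = g z) ->
  exists t, [/\ self_adjoint_projection q' t, forall z, t (f z) = f (r z) &
    forall z, r z = z -> t (g z) = g z].
Proof.
move=> qq qns qq' fM gM [rL rr radj] fg; have [fL _] := fM.
have [fs fsL fsP] := exists_adjoint qq qns qq' fL; have [qinj _] := qns.
have fsK z : fs (f z) = z.
  by apply: qinj; apply/funext => x; rewrite fsP (qmorph_polar _ _ fM).
have r0 z : r (z - r z) = 0 by rewrite (RlinearB rL) rr subrr.
have tf z : f z - f (fs (f z) - r (fs (f z))) = f (r z).
  by rewrite fsK (RlinearB fL) subKr.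
exists (fun y => y - f (fs y - r (fs y))); split=> //.
  split=> [a y z|y|y z].
  - rewrite fsL rL opprD addrACA -scalerBr fL opprD addrACA -scalerN -scalerDr.
    by rewrite scalerBr.
  - rewrite (RlinearB fsL) fsK (RlinearB rL) r0 subr0.
    by rewrite subKr subrr (Rlinear0 fL) subr0.
  - rewrite !(polarE qq') (polarC _ (f _) z) -!fsP !(polarE qq).
    by rewrite (polarC _ (fs z) (fs y)) (polarC _ (fs z)) radj.
move=> z rz; suff -> : fs (g z) - r (fs (g z)) = 0 by rewrite (Rlinear0 fL) subr0.
apply: qinj; apply/funext => x; rewrite (polar0l qq).
have -> : polar q (fs (g z) - r (fs (g z))) x = polar q (fs (g z)) (x - r x).
  by rewrite !(polarE qq) radj.
by rewrite fsP fg ?r0 // (qmorph_polar _ _ gM) !(polarE qq) -radj rz subrr.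
Qed.

Lemma qaut_extension n (X Y : QuadMod R) (r : X -> X) (f g : X -> Y) :
  self_adjoint_projection (qform X) r -> gram_vanish n.+1 (qform X) r ->
  is_qmorph (qform X) (qform Y) f -> is_qmorph (qform X) (qform Y) g ->
  (forall z, r z = 0 -> f z = g z) ->
  exists s, is_qaut (qform Y) s /\ g = s \o f.
Proof.
have qX := qform_quadratic X; have qY := qform_quadratic Y.
have nX := qform_nonsingular X; have nY := qform_nonsingular Y.
(* In the base case [polar] vanishes on the diagonal of the image of [r], so by polarization and
   non-singularity [r = 0]. *)
elim: n r f g => [|n IH] r f g rP gr fM gM fg; have [rL rr radj] := rP.
  have bz z : polar (qform X) (r z) (r z) = 0.
    by have := gr (fun=> z); rewrite det_mx11 mxE.
  exists id; split; first exact: qaut_id.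
  apply/funext => z; rewrite /= -fg //; have [qinj _] := nX.
  apply: qinj; apply/funext => w; rewrite (polar0l qX) -rr radj.
  have := bz (z + w); rewrite (RlinearD rL) !(polarE qX) !bz add0r addr0.
  rewrite (polarC _ (r w)) => bzw.
  rewrite -(mul1r (polar _ _ _)) -h2 mulrAC [2 * _]mulrC.
  by rewrite (_ : _ * 2 = 0) ?mul0r // -bzw; ring.
have [x [u [rx uu ur]]] := exists_regular_vector qX nX (@qcarrier_fgp _ X) rP.
have ux : (u * qform X x) *: x = x by have := ur x; rewrite rx.
have [t [tP tf tg]] := orth_image_projection qX nX qY fM gM rP fg.
have [fL fq] := fM; have [gL gq] := gM.
have [||||||s [saut sfx st]] :=
  @qaut_transitive_line _ _ t (f x) (g x) u qY nY (@qcarrier_fgp _ Y) tP.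
- by rewrite tf rx.
- exact: tg.
- by rewrite fq gq.
- by rewrite fq.
- by rewrite fq -(RlinearZ fL) ux.
- by rewrite fq -(RlinearZ gL) ux.
have [sM _] := saut; have [sL sq] := sM.
have [|||||s' [s'aut gE]] := IH (split_off (qform X) r x u) (s \o f) g.
- exact: split_off_projection.
- exact: gram_vanish_split_off.
- by split; [exact: Rlinear_comp|move=> z; rewrite /= sq].
- exact: gM.
(* Such a [z] is the sum of an element of [ker r], which [s] does not disturb, and a multiple of
   [x]. *)
- move=> z /eqP; rewrite subr_eq0 => /eqP rz.
  have r0 : r (z - r z) = 0 by rewrite (RlinearB rL) rr subrr.
  rewrite -(subrK (r z) z) /= (RlinearD fL) (RlinearD sL) (RlinearD gL).
  congr (_ + _); first by rewrite -(fg _ r0) st // tf r0 (Rlinear0 fL).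
  by rewrite rz (RlinearZ fL) (RlinearZ sL) sfx (RlinearZ gL).
by exists (s' \o s); split; [exact: qaut_comp|rewrite gE].
Qed.

Lemma qaut_transitive (X Y : QuadMod R) (f g : X -> Y) :
  is_qmorph (qform X) (qform Y) f -> is_qmorph (qform X) (qform Y) g ->
  exists s, is_qaut (qform Y) s /\ g = s \o f.
Proof.
move=> fM gM.
have [n gr] := fg_projective_gram_vanish (qform_quadratic X) (@qcarrier_fgp _ X).
apply: (qaut_extension _ gr fM gM) => [|z ->]; first by split.
by rewrite (Rlinear0 fM.1) (Rlinear0 gM.1).
Qed.

End Extension.

(** * The zero module and automorphisms of orthogonal sums *)

Section OrthogonalSum.
Variable R : comPzRingType.

Lemma zero_form_initial (X : QuadMod R) :
  (exists f : ZeroMod R -> X, is_qmorph (@zero_form R) (qform X) f) /\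
  (forall f g : ZeroMod R -> X,
     is_qmorph (@zero_form R) (qform X) f ->
     is_qmorph (@zero_form R) (qform X) g -> f = g).
Proof.
split=> [|f g [fL _] [gL _]].
  exists (fun=> 0); split=> [a x y|x]; first by rewrite scaler0 addr0.
  by rewrite (qform0 (qform_quadratic X)).
by apply/funext => x; rewrite (thinmx0 x) (Rlinear0 fL) (Rlinear0 gL).
Qed.

Lemma osum_map_qaut (V W : lmodType R) (q : V -> R) (q' : W -> R) (f : V -> V) :
  is_qaut q f -> is_qaut (osum_form q q') (osum_map f id).
Proof.
have ext g : is_qmorph q q g ->
    is_qmorph (osum_form q q') (osum_form q q') (osum_map g id).
  move=> [gL gq]; split=> [a [x1 x2] [y1 y2]|[x1 x2]].
    by rewrite /osum_map /= gL.
  by rewrite /osum_form /osum_map /= gq.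
move=> [fM [g [gM fK gK]]]; split; first exact: ext.
exists (osum_map g id); split; first exact: ext.
  by move=> [x y]; rewrite /osum_map /= fK.
by move=> [x y]; rewrite /osum_map /= gK.
Qed.

Lemma osum_map_inj (V W : lmodType R) (f g : V -> V) :
  osum_map f (@id W) = osum_map g id -> f = g.
Proof. by move=> fg; apply/funext => x; have := congr1 (fun h => (h (x, 0)).1) fg. Qed.

(* [phi (x, 0)] is orthogonal to [phi (0, y) = (0, y)] for every [y], so its second
   component vanishes. *)
Lemma qmorph_osum_fix (V W : lmodType R) (q : V -> R) (q' : W -> R)
    (phi : V * W -> V * W) :
  quadratic_form q -> quadratic_form q' -> nonsingular q' ->
  is_qmorph (osum_form q q') (osum_form q q') phi ->
  (forall y, phi (0, y) = (0, y)) ->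
  exists2 f, is_qmorph q q f & phi = osum_map f id.
Proof.
move=> qq qq' [qinj _] phiM phi0; have [phiL phiq] := phiM.
have bE x y : polar (osum_form q q') x y = polar q x.1 y.1 + polar q' x.2 y.2.
  by rewrite /polar /osum_form /=; ring.
have phi2 x : (phi (x, 0)).2 = 0.
  apply: qinj; apply/funext => y; rewrite (polar0l qq').
  have := qmorph_polar (x, 0) (0, y) phiM.
  by rewrite phi0 !bE /= !(polar0r qq) (polar0l qq') !add0r.
have phiE x y : phi (x, y) = ((phi (x, 0)).1, y).
  have -> : (x, y) = (x, 0) + (0, y) :> V * W by congr (_, _); rewrite /= ?addr0 ?add0r.
  rewrite (RlinearD phiL) phi0 [LHS]surjective_pairing /= phi2.
  by rewrite ?addr0 ?add0r.
exists (fun x => (phi (x, 0)).1); last by apply/funext => -[x y]; rewrite phiE.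
split=> [a x y|x].
  have -> : (a *: x + y, 0) = a *: (x, 0) + (y, 0) :> V * W.
    by congr (_, _); rewrite /= scaler0 addr0.
  by rewrite phiL.
by have := phiq (x, 0); rewrite phiE /osum_form /= (qform0 qq') !addr0.
Qed.

(** The inverse of [phi] also fixes the second summand, so it splits too, and its first component
    inverts [f]. *)
Lemma qaut_osum_fix (V W : lmodType R) (q : V -> R) (q' : W -> R)
    (phi : V * W -> V * W) :
  quadratic_form q -> quadratic_form q' -> nonsingular q' ->
  is_qaut (osum_form q q') phi -> (forall y, phi (0, y) = (0, y)) ->
  exists f, is_qaut q f /\ phi = osum_map f id.
Proof.
move=> qq qq' qns [phiM [psi [psiM phiK psiK]]] phi0.
have psi0 y : psi (0, y) = (0, y) by rewrite -{1}(phi0 y) phiK.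
have [f fM fE] := qmorph_osum_fix qq qq' qns phiM phi0.
have [g gM gE] := qmorph_osum_fix qq qq' qns psiM psi0.
exists f; split=> //; split=> //; exists g; split=> // x.
  by have := phiK (x, 0); rewrite fE gE => -[].
by have := psiK (x, 0); rewrite fE gE => -[].
Qed.

End OrthogonalSum.

Theorem theorem3p3 (R : comPzRingType) :
  semi_local R -> (exists u : R, 2 * u = 1) -> quad_homogeneous R.
Proof.
move=> Rsl [h h2]; split; first exact: zero_form_initial.
split; first by move=> X Y f g; apply: (qaut_transitive h2 Rsl).
move=> X Y qXY; split; [|split].
- move=> f faut; split; first exact: osum_map_qaut.
  apply/funext => y; rewrite /osum_map /iota_r /=.
  by have [[fL _] _] := faut; rewrite (Rlinear0 fL).
- by move=> f g _ _; apply: osum_map_inj.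
- move=> phi phiaut phi0.
  apply: (qaut_osum_fix (qform_quadratic X) (qform_quadratic Y)
    (qform_nonsingular Y) phiaut) => y.
  exact: (congr1 (fun F => F y) phi0).
Qed.
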